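(* For any Cantor minimal system $(X,\varphi)$ there is a unique (up to conjugacy) odometer $(Y,\psi)$ with the following properties: (1) $(Y,\psi)$ is a factor of $(X,\varphi)$; (2) every odometer which is a factor of $(X,\varphi)$ is also a factor of $(Y,\psi)$. Moreover, there is a factor map $\alpha:(X,\varphi)\to(Y,\psi)$ such that, if $\beta:(X,\varphi)\to(Z,\eta)$ is a factor map onto an odometer $(Z,\eta)$, then there is a (necessarily unique) factor map $\gamma:(Y,\psi)\to(Z,\eta)$ such that $\beta=\gamma\circ\alpha$.
   Context: A Cantor minimal system $(X,\varphi)$ is a minimal homeomorphism $\varphi$ of a space $X$ homeomorphic to the Cantor set. A factor map $(X,\varphi)\to(Y,\psi)$ is a continuous surjection $\alpha:X\to Y$ with $\alpha\circ\varphi=\psi\circ\alpha$; $(Y,\psi)$ is then a factor of $(X,\varphi)$. A conjugacy is a factor map that is a homeomorphism. For a sequence $(k_n)_{n\ge1}$ of positive integers, an odometer of type $(k_n)_{n\ge1}$ is the minimal system $(X,\varphi)$ with $X=\prod_{n=1}^\infty\{0,1,\ldots,k_n-1\}$ and $\varphi$ the addition of $(1,0,0,\ldots)$ with carrying (to the right). Trivial odometers, with $X$ finite (i.e. $k_n=1$ for all but finitely many $n$), are included. *)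

(* Defs.v *)
From HB Require Import structures.
From mathcomp Require Import all_boot.
From mathcomp Require Import boolp classical_sets functions.
From mathcomp Require Import topology cantor.

Set Implicit Arguments.
Unset Strict Implicit.
Unset Printing Implicit Defensive.

Local Open Scope classical_set_scope.

Definition homeomorphism (X Y : topologicalType) (f : X -> Y) : Prop :=
  continuous f /\
  exists g : Y -> X, [/\ continuous g, cancel f g & cancel g f].

Definition minimal_homeomorphism (X : topologicalType) (phi : X -> X) : Prop :=
  homeomorphism phi /\
  forall A : set X, closed A -> phi @` A = A -> A = set0 \/ A = [set: X].

Definition cantor_minimal_system (X : topologicalType) (phi : X -> X) : Prop :=
  (exists f : X -> cantor_space, homeomorphism f) /\
  minimal_homeomorphism phi.

Definition factor_map (X Y : topologicalType) (phi : X -> X) (psi : Y -> Y)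
    (alpha : X -> Y) : Prop :=
  [/\ continuous alpha, range alpha = [set: Y]
    & forall x : X, alpha (phi x) = psi (alpha x)].

Definition is_factor (X Y : topologicalType) (phi : X -> X) (psi : Y -> Y)
    : Prop :=
  exists alpha : X -> Y, factor_map phi psi alpha.

Definition conjugate (X Y : topologicalType) (phi : X -> X) (psi : Y -> Y)
    : Prop :=
  exists alpha : X -> Y, factor_map phi psi alpha /\ homeomorphism alpha.

(* The sequence (k_1, k_2, ...) is indexed from 0. *)
Definition odometer_type (k : nat -> nat) : Prop := forall n : nat, 0 < k n.

Definition odometer_space (k : nat -> nat) : Type :=
  prod_topology (fun n : nat => discrete_topology 'I_(k n)).

HB.instance Definition _ (k : nat -> nat) := Nbhs.on (odometer_space k).
HB.instance Definition _ (k : nat -> nat) := Topological.on (odometer_space k).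
HB.instance Definition _ (k : nat -> nat) := Uniform.on (odometer_space k).

(* The carry reaches digit n exactly when every earlier digit is maximal;
   [ordS] increments a digit modulo [k n]. *)
Definition odometer (k : nat -> nat) (x : odometer_space k)
    : odometer_space k :=
  fun n : nat =>
    let digit (i : nat) : 'I_(k i) := x i in
    if [forall i : 'I_n, (digit i).+1 == k i] then ordS (digit n)
    else digit n.

(* Every odometer that is a factor of [phi] is a factor of [odometer k],
   which is itself a factor of [phi]. *)
Definition maximal_odometer_factor (X : topologicalType) (phi : X -> X)
    (k : nat -> nat) : Prop :=
  [/\ odometer_type k,
      is_factor phi (@odometer k)
    & forall l : nat -> nat, odometer_type l ->
        is_factor phi (@odometer l) -> is_factor (@odometer k) (@odometer l)].

(* Main.v *)
Require Import Defs.
From mathcomp Require Import all_boot.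
From mathcomp Require Import boolp classical_sets functions.
From mathcomp Require Import topology cantor.

Set Implicit Arguments.
Unset Strict Implicit.
Unset Printing Implicit Defensive.

Local Open Scope classical_set_scope.

(** An odometer is the inverse limit of the rotations of Z/K_n, where
    K_n = k_0 ... k_(n-1), so its factor maps are governed by finite data.
    Call a continuous map c to Z/m with c (psi y) = c y + 1 a clock modulo m:
    it is a factor map onto the rotation of Z/m.  The whole theorem reduces to
    arithmetic of the moduli that admit clocks.

    - Rigidity ([clock_unique]).  In an indecomposable system, where no proper
      nonempty clopen set is invariant, two clocks modulo m differ by a
      constant: the clopen set where they agree is invariant.  Minimal systems
      are indecomposable, and so are their factors.
    - Moduli form a lattice ([has_clock_dvd], [has_clock_lcm]).  They are closed
      under divisors and least common multiples.
    - Criterion ([factor_of_clocks]).  A compact indecomposable system maps onto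
      the odometer of type l as soon as it has clocks modulo all partial
      products L_n, and the image of one point may be prescribed.  Normalised at
      that point, the clocks are coherent by rigidity, hence define a point of
      the inverse limit; compactness gives surjectivity.  Rigidity also shows
      that a factor map to an odometer is determined by its value at one point
      ([factor_map_odometer_unique]).

    Take k such that the partial products K_n are moduli of clocks of phi and
    every such modulus divides some K_n: let K_n be the least common multiple of
    the moduli at most n.  By the criterion there is a factor map alpha onto
    the odometer of type k.  If beta maps phi onto the odometer of type l, each
    L_n is a modulus for phi, hence divides some K_N, so the odometer of type k
    has a clock modulo L_n.  The criterion yields a factor map gamma with
    gamma (alpha x0) = beta x0, and beta = gamma o alpha because both agree at
    x0.  Finally, two odometers that are factors of each other are conjugate:
    choose the two maps so that they exchange two given points; both composites
    then fix a point, hence are the identity. *)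

(** * Locally constant functions *)

Definition locally_constant (Y : topologicalType) (T : Type) (f : Y -> T) :=
  forall x : Y, \forall y \near x, f y = f x.

Lemma locally_constant_cst (Y : topologicalType) (T : Type) (t : T) :
  locally_constant (fun _ : Y => t).
Proof. by move=> x; apply: nearW. Qed.

Lemma locally_constant_comp (Y : topologicalType) (T U : Type) (g : T -> U)
    (f : Y -> T) :
  locally_constant f -> locally_constant (g \o f).
Proof. by move=> lf x; apply: filterS (lf x) => y /= ->. Qed.

Lemma locally_constant2 (Y : topologicalType) (T U V : Type) (g : T -> U -> V)
    (f1 : Y -> T) (f2 : Y -> U) :
  locally_constant f1 -> locally_constant f2 ->
  locally_constant (fun y => g (f1 y) (f2 y)).
Proof. by move=> l1 l2 x; apply: filterS2 (l1 x) (l2 x) => y -> ->. Qed.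

Lemma locally_constant_precomp (X Y : topologicalType) (T : Type)
    (alpha : X -> Y) (f : Y -> T) :
  continuous alpha -> locally_constant f -> locally_constant (f \o alpha).
Proof. by move=> ca lf x; apply: ca (lf (alpha x)). Qed.

(** The topology on an odometer is the product of discrete ones, so continuity
    is checked digit by digit. *)
Lemma continuous_odometerP (Y : topologicalType) (k : nat -> nat)
    (alpha : Y -> odometer_space k) :
  continuous alpha <-> forall n, locally_constant (fun y => alpha y n).
Proof.
split=> [ca n x|lc x].
- have cproj : continuous (fun z : odometer_space k => z n).
    exact: (@proj_continuous nat (fun n => discrete_topology 'I_(k n)) n).
  have cx := continuous_comp (ca x) (cproj (alpha x)).
  by move/discrete_cvg: cx.
- apply/cvg_sup => n; move: x.
  pose W := initial_topology (fun z : odometer_space k => z n).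
  apply/(@continuousP _ W) => _ [V _ <-]; rewrite openE => x /= Vx.
  by apply: filterS (lc n x) => y; rewrite /preimage /= => ->.
Qed.

(** * Indecomposable systems *)

(** Locally constant predicates are the clopen sets, so this is minimality
    tested on clopen sets only.  Invariance is a condition on the values of
    the predicate, and so pulls back along factor maps. *)
Definition indecomposable (Y : topologicalType) (psi : Y -> Y) :=
  forall P : Y -> Prop, locally_constant P ->
    (forall y, P (psi y) = P y) -> forall y0, P y0 -> forall y, P y.

Lemma minimal_indecomposable (X : topologicalType) (phi : X -> X) :
  minimal_homeomorphism phi -> indecomposable phi.
Proof.
move=> [[_ [phi' [_ phiK phi'K]]] minphi] P lP Pphi y0 Py0.
have clP : closed [set y | P y].
  rewrite -openC openE => x /= nPx.
  by apply: filterS (lP x) => y /= ->.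
have imP : phi @` [set y | P y] = [set y | P y].
  rewrite eqEsubset; split=> [_ [x /= Px <-]|y /= Py]; first by rewrite Pphi.
  by exists (phi' y) => //=; rewrite -Pphi phi'K.
case: (minphi _ clP imP) => [P0|PT] y.
- by have : [set y | P y] y0 by []; rewrite P0.
- by have : [set: X] y by []; rewrite -PT.
Qed.

Lemma factor_indecomposable (X Y : topologicalType) (phi : X -> X)
    (psi : Y -> Y) :
  is_factor phi psi -> indecomposable phi -> indecomposable psi.
Proof.
move=> [alpha [ca sa ea]] iphi P lP Ppsi y0 Py0 y.
have [x0 _ ax0] : range alpha y0 by rewrite sa.
rewrite -ax0 in Py0.
have [x _ <-] : range alpha y by rewrite sa.
apply: (iphi (P \o alpha) _ _ x0 Py0 x) => [|z /=]; last by rewrite ea.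
exact: locally_constant_precomp.
Qed.

Lemma factor_compact (X Y : topologicalType) (phi : X -> X) (psi : Y -> Y) :
  is_factor phi psi -> compact [set: X] -> compact [set: Y].
Proof.
move=> [alpha [ca sa _]] cX; rewrite -sa.
by apply: continuous_compact cX; exact: continuous_subspaceT.
Qed.

Lemma factor_map_comp (X Y Z : topologicalType) (phi : X -> X) (psi : Y -> Y)
    (eta : Z -> Z) (alpha : X -> Y) (beta : Y -> Z) :
  factor_map phi psi alpha -> factor_map psi eta beta ->
  factor_map phi eta (beta \o alpha).
Proof.
move=> [ca sa ea] [cb sb eb]; split=> [x||x /=].
- exact: continuous_comp (ca x) (cb (alpha x)).
- by rewrite -(image_comp alpha beta) sa sb.
- by rewrite ea eb.
Qed.

(** * Clocks *)

(** A factor map to the rotation of Z/m, written with natural numbers read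
    modulo m.  The values are not reduced, so that a clock modulo n is literally
    a clock modulo each divisor of n. *)
Definition clock (Y : topologicalType) (psi : Y -> Y) (m : nat)
    (c : Y -> nat) :=
  locally_constant c /\ forall y, c (psi y) = c y + 1 %[mod m].

Definition has_clock (Y : topologicalType) (psi : Y -> Y) (m : nat) :=
  exists c, clock psi m c.

Lemma clock_dvd (Y : topologicalType) (psi : Y -> Y) m n c :
  m %| n -> clock psi n c -> clock psi m c.
Proof.
move=> mn [lc cS]; split=> // y.
by rewrite -(modn_dvdm (c (psi y)) mn) cS modn_dvdm.
Qed.

Lemma has_clock_dvd (Y : topologicalType) (psi : Y -> Y) m n :
  m %| n -> has_clock psi n -> has_clock psi m.
Proof. by move=> mn [c cc]; exists c; exact: clock_dvd cc. Qed.

Lemma has_clock1 (Y : topologicalType) (psi : Y -> Y) : has_clock psi 1.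
Proof.
by exists (fun=> 0); split=> [|y]; [exact: locally_constant_cst|rewrite !modn1].
Qed.

Lemma clock_precomp (X Y : topologicalType) (phi : X -> X) (psi : Y -> Y)
    (alpha : X -> Y) m c :
  factor_map phi psi alpha -> clock psi m c -> clock phi m (c \o alpha).
Proof.
move=> [ca _ ea] [lc cS]; split=> [|x /=]; last by rewrite ea cS.
exact: locally_constant_precomp.
Qed.

Lemma clock_iter (Y : topologicalType) (psi : Y -> Y) m c j y :
  clock psi m c -> c (iter j psi y) = c y + j %[mod m].
Proof.
move=> [_ cS]; elim: j => [|j IHj]; first by rewrite addn0.
by rewrite iterS cS -modnDml IHj modnDml addn1 addnS.
Qed.

(** In truncated arithmetic, [a * m.-1] plays the part of the opposite of [a]
    modulo [m]. *)
Lemma modn_complement m a t : 0 < m -> a + (t + a * m.-1) = t %[mod m].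
Proof.
by move=> m0; rewrite addnCA -mulnS prednK // addnC modnMDl.
Qed.

Lemma clock_shift (Y : topologicalType) (psi : Y -> Y) m (y0 : Y) t :
  0 < m -> has_clock psi m ->
  exists c, clock psi m c /\ c y0 = t %[mod m].
Proof.
move=> m0 [c [lc cS]]; exists (fun y => c y + (t + c y0 * m.-1)); split.
- split=> [|y]; first exact: (locally_constant_comp (addn^~ _) lc).
  by rewrite -modnDml cS modnDml addnAC.
- exact: modn_complement.
Qed.

(** The clopen set where both clocks agree is invariant, because both advance
    by one. *)
Lemma clock_unique (Y : topologicalType) (psi : Y -> Y) m c c' (y0 : Y) :
  indecomposable psi -> clock psi m c -> clock psi m c' ->
  c y0 = c' y0 %[mod m] -> forall y, c y = c' y %[mod m].
Proof.
move=> ipsi [lc cS] [lc' cS']; apply: (ipsi (fun y => c y = c' y %[mod m])).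
- exact: (locally_constant2 (fun a b => a = b %[mod m]) lc lc').
- move=> y; rewrite cS cS'; apply/propext; split=> /eqP.
  + by rewrite eqn_modDr => /eqP.
  + by move=> h; apply/eqP; rewrite eqn_modDr.
Qed.

Lemma eqn_mod_lcm m n p q :
  p = q %[mod m] -> p = q %[mod n] -> p == q %[mod lcmn m n].
Proof.
wlog pq : p q / p <= q => [W|] /eqP h1 /eqP h2.
  by case/orP: (leq_total p q) => /W; [|rewrite eq_sym];
     apply; apply/eqP; rewrite // eq_sym.
by rewrite eq_sym eqn_mod_dvd // dvdn_lcm -!eqn_mod_dvd // eq_sym h1 eq_sym.
Qed.

(** Normalise both clocks to vanish at a point.  The pairs (c y, d y) then stay
    in the orbit of (0, 0) under adding (1, 1) in Z/m x Z/n, by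
    indecomposability; that orbit is cyclic of order lcm m n, and the number of
    steps needed to reach (c y, d y) is the desired clock. *)
Lemma has_clock_lcm (Y : topologicalType) (psi : Y -> Y) m n (y0 : Y) :
  0 < m -> 0 < n -> indecomposable psi ->
  has_clock psi m -> has_clock psi n -> has_clock psi (lcmn m n).
Proof.
move=> m0 n0 ipsi /(clock_shift y0 0 m0)[c [cc c0]].
move=> /(clock_shift y0 0 n0)[d [dd d0]].
pose both a b j := j = a %[mod m] /\ j = b %[mod n].
have reached y : exists j, both (c y) (d y) j.
  apply: (ipsi (fun y => exists j, both (c y) (d y) j) _ _ y0).
  - exact: (locally_constant2 (fun a b => exists j, both a b j) cc.1 dd.1).
  - move=> z; apply/propext; split=> -[j [jc jd]].
    (* One step back is [m * n - 1] steps forward in both coordinates. *)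
    + exists (j + (m * n).-1); split; apply/eqP; rewrite -(eqn_modDr 1).
      * rewrite -cc.2 -jc -addnA addn1 prednK ?muln_gt0 ?m0 //.
        by rewrite addnC mulnC modnMDl.
      * rewrite -dd.2 -jd -addnA addn1 prednK ?muln_gt0 ?m0 //.
        by rewrite addnC modnMDl.
    + exists (j + 1); split.
      * by rewrite cc.2 -modnDml jc modnDml.
      * by rewrite dd.2 -modnDml jd modnDml.
  - by exists 0; rewrite /both c0 d0.
(* A choice made from [c y] and [d y] alone is locally constant in [y]. *)
pose e y := xget 0 [set j | both (c y) (d y) j].
have eP y : both (c y) (d y) (e y) := xgetPex 0 (reached y).
exists e; split=> [|y].
  exact: (locally_constant2 (fun a b => xget 0 [set j | both a b j]) cc.1 dd.1).
apply/eqP; have [[ec ed] [esc esd]] := (eP y, eP (psi y)).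
apply: eqn_mod_lcm.
- by rewrite esc cc.2 -modnDml -ec modnDml.
- by rewrite esd dd.2 -modnDml -ed modnDml.
Qed.

(** * Odometers as inverse limits *)

Definition radix (k : nat -> nat) n := \prod_(i < n) k i.

Definition odo_val (k : nat -> nat) n (x : odometer_space k) :=
  \sum_(i < n) radix k i * (x i : 'I_(k i)).

Lemma radixS k n : radix k n.+1 = radix k n * k n.
Proof. by rewrite /radix big_ord_recr. Qed.

Lemma radix_gt0 k n : odometer_type k -> 0 < radix k n.
Proof. by move=> k0; rewrite prodn_gt0. Qed.

Lemma odo_valS k n (x : odometer_space k) :
  odo_val n.+1 x = odo_val n x + radix k n * (x n : 'I_(k n)).
Proof. by rewrite /odo_val big_ord_recr. Qed.

Lemma odo_val_lt k n (x : odometer_space k) :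
  odo_val n x < radix k n.
Proof.
elim: n => [|n IHn]; first by rewrite /odo_val /radix !big_ord0.
rewrite odo_valS radixS; have := ltn_ord (x n : 'I_(k n)).
set d := nat_of_ord _ => dk.
apply: (@leq_trans (radix k n * d.+1)); last by rewrite leq_mul2l dk orbT.
by rewrite mulnS ltn_add2r.
Qed.

Lemma odo_val_mod k n (x : odometer_space k) :
  odo_val n.+1 x = odo_val n x %[mod radix k n].
Proof. by rewrite odo_valS addnC mulnC modnMDl. Qed.

(** Uniqueness of the mixed radix expansion: the residues [odo_val n x] are the
    coordinates of [x] in the inverse limit of the groups Z/K_n. *)
Lemma odo_val_digits k n (x y : odometer_space k) : odometer_type k ->
  odo_val n x = odo_val n y %[mod radix k n] ->
  forall i, i < n -> x i = y i.
Proof.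
move=> k0; elim: n => // n IHn xy i; rewrite ltnS leq_eqVlt.
have xyn : odo_val n x = odo_val n y %[mod radix k n].
  have dv : radix k n %| radix k n.+1 by rewrite radixS dvdn_mulr.
  by rewrite -odo_val_mod -(modn_dvdm _ dv) xy modn_dvdm // odo_val_mod.
case/predU1P => [->|]; last exact: IHn.
apply/val_inj/eqP; move: xy xyn; rewrite !modn_small ?odo_val_lt // !odo_valS.
by move=> /[swap] -> /eqP; rewrite eqn_add2l eqn_pmul2l ?radix_gt0.
Qed.

Lemma odo_val_inj k (x y : odometer_space k) : odometer_type k ->
  (forall n, odo_val n x = odo_val n y %[mod radix k n]) -> x = y.
Proof.
move=> k0 xy; apply: functional_extensionality_dep => n.
exact: (odo_val_digits k0 (xy n.+1)).
Qed.

Definition carry k n (x : odometer_space k) :=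
  [forall i : 'I_n, (x i : 'I_(k i)).+1 == k i].

Lemma carryS k n (x : odometer_space k) :
  carry n.+1 x = carry n x && ((x n : 'I_(k n)).+1 == k n).
Proof.
apply/forallP/andP=> [h|[/forallP h hn] i].
- by split; [apply/forallP => i; have := h (widen_ord (leqnSn n) i)|
             have := h ord_max].
- have [ni|ni] := ltnP i n; first exact: (h (Ordinal ni)).
  by have -> : i = ord_max by apply/val_inj/eqP; rewrite eqn_leq -ltnS ltn_ord.
Qed.

(** Adding one with carry really adds one, except that a carry out of the first
    [n] digits is lost. *)
Lemma odo_val_odometer k n (x : odometer_space k) :
  odo_val n (odometer x) + carry n x * radix k n = odo_val n x + 1.
Proof.
elim: n => [|n IHn].
  rewrite /odo_val /radix !big_ord0.
  by have -> : carry 0 x by apply/forallP => -[].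
rewrite !odo_valS carryS radixS {2}/odometer -/(carry n x).
rewrite [RHS]addnAC -{}IHn.
case: (carry n x); last by rewrite !mul0n !addn0.
rewrite andTb mul1n /=.
have := ltn_ord (x n : 'I_(k n)).
case: eqP => [e _|/eqP ne lt].
- by rewrite e modnn muln0 addn0 mul1n -addnA -mulnS e.
- have {}lt : (x n : 'I_(k n)).+1 < k n by rewrite ltn_neqAle ne.
  by rewrite modn_small // mul0n addn0 mulnS addnA.
Qed.

Lemma clock_odo_val k n : clock (@odometer k) (radix k n) (@odo_val k n).
Proof.
split=> [|x]; last by rewrite -odo_val_odometer addnC modnMDl.
have lc := (continuous_odometerP (@id (odometer_space k))).1 (fun=> cvg_id).
elim: n => [|n IHn].
  have -> : @odo_val k 0 = cst 0.
    by apply/funext => x; rewrite /odo_val big_ord0.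
  exact: locally_constant_cst.
have -> : @odo_val k n.+1 =
    fun x => odo_val n x + radix k n * (x n : 'I_(k n)).
  by apply/funext => x; rewrite odo_valS.
pose add_digit a (d : 'I_(k n)) := a + radix k n * d.
exact: (locally_constant2 add_digit IHn (lc n)).
Qed.

(** Every coherent family of residues is a point of the inverse limit; its n-th
    digit is read off the residue modulo the next partial product. *)
Lemma odo_val_surj k (s : nat -> nat) : odometer_type k ->
  (forall n, s n.+1 = s n %[mod radix k n]) ->
  exists x : odometer_space k, forall n, odo_val n x = s n %[mod radix k n].
Proof.
move=> k0 coh.
exists (fun n => Ordinal (ltn_pmod (s n.+1 %/ radix k n) (k0 n))) => n.
rewrite [LHS]modn_small ?odo_val_lt //.
elim: n => [|n IHn]; first by rewrite /odo_val /radix !big_ord0 modn1.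
rewrite odo_valS IHn -coh /= modn_divl mulnC radixS [k n * _]mulnC.
rewrite [RHS](divn_eq _ (radix k n)) addnC modn_dvdm //.
by rewrite dvdn_mulr.
Qed.

(** Clocks normalised by their values at [y0] are coherent by rigidity, so they
    define a map to the inverse limit.  It is onto: the orbit of [y0] reaches
    any finite string of digits, and a cluster point of these approximations has
    all the required digits. *)
Lemma factor_of_clocks (Y : topologicalType) (psi : Y -> Y) (l : nat -> nat)
    (y0 : Y) (z0 : odometer_space l) :
  odometer_type l -> compact [set: Y] -> indecomposable psi ->
  (forall n, has_clock psi (radix l n)) ->
  exists gamma, factor_map psi (@odometer l) gamma /\ gamma y0 = z0.
Proof.
move=> l0 cY ipsi clocks.
have /choice[c cP] n :=
  clock_shift y0 (odo_val n z0) (radix_gt0 n l0) (clocks n).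
have coh y n : c n.+1 y = c n y %[mod radix l n].
  have dv : radix l n %| radix l n.+1 by rewrite radixS dvdn_mulr.
  apply: (clock_unique ipsi (clock_dvd dv (cP n.+1).1) (cP n).1 (y0 := y0)).
  by rewrite -(modn_dvdm _ dv) (cP n.+1).2 modn_dvdm // odo_val_mod (cP n).2.
have /choice[gamma gP] y := odo_val_surj l0 (coh y).
have gval y z n : c n y = odo_val n z %[mod radix l n] ->
    forall i, i < n -> gamma y i = z i.
  by move=> yz; apply: odo_val_digits; rewrite // gP.
have cg : continuous gamma.
  apply/continuous_odometerP => n x.
  apply: filterS ((cP n.+1).1.1 x) => y yx.
  by apply: (gval _ _ n.+1) => //; rewrite yx gP.
exists gamma; split; last first.
  by apply: odo_val_inj => // n; rewrite gP (cP n).2.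
split=> //; last first.
  move=> y; apply: odo_val_inj => // n.
  rewrite gP (cP n).1.2 (clock_odo_val l n).2.
  by rewrite -[in RHS]modnDml gP modnDml.
rewrite eqEsubset; split=> // z _.
(* After this many steps the n-th clock shows the n-th residue of [z]. *)
pose u n := iter (odo_val n z + c n y0 * (radix l n).-1) psi y0.
have uP n i : i < n -> gamma (u n) i = z i.
  apply: gval; rewrite (clock_iter _ _ (cP n).1).
  by rewrite modn_complement // radix_gt0.
have [y [_ cly]] := cY (u @ \oo) _ filterT.
exists y => //; apply: functional_extensionality_dep => i.
have eventually_z : (u @ \oo) [set y' | gamma y' i = z i].
  by exists i.+1 => // n /= ni; exact: uP.
have near_y := (continuous_odometerP gamma).1 cg i y.
by have [y' [/= <- ->]] := cly _ _ eventually_z near_y.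
Qed.

Lemma factor_map_odometer_unique (Y : topologicalType) (psi : Y -> Y)
    (l : nat -> nat) (gamma gamma' : Y -> odometer_space l) (y0 : Y) :
  odometer_type l -> indecomposable psi ->
  factor_map psi (@odometer l) gamma -> factor_map psi (@odometer l) gamma' ->
  gamma y0 = gamma' y0 -> gamma = gamma'.
Proof.
move=> l0 ipsi fg fg' g0; apply/funext => y; apply: odo_val_inj => // n.
have cl := clock_odo_val l n.
apply: (clock_unique ipsi (clock_precomp fg cl) (clock_precomp fg' cl)
  (y0 := y0)).
by rewrite /= g0.
Qed.

Lemma factor_has_clock (Y : topologicalType) (psi : Y -> Y) (l : nat -> nat) n :
  is_factor psi (@odometer l) -> has_clock psi (radix l n).
Proof.
move=> [g fg]; exists (odo_val n \o g).
exact: clock_precomp (clock_odo_val l n).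
Qed.

(** * The largest odometer type *)

Fixpoint lcm_upto (E : nat -> Prop) n :=
  if n is m.+1 then
    if `[< E m.+1 >] then lcmn (lcm_upto E m) m.+1 else lcm_upto E m
  else 1.

Lemma lcm_upto_gt0 E n : 0 < lcm_upto E n.
Proof. by elim: n => //= n IHn; case: asboolP => // _; rewrite lcmn_gt0 IHn. Qed.

Lemma dvdn_lcm_upto (E : nat -> Prop) m : 0 < m -> E m -> m %| lcm_upto E m.
Proof.
by case: m => // m _ Em /=; case: asboolP => // _; exact: dvdn_lcmr.
Qed.

(** The type is made of the quotients of the successive least common multiples
    of the moduli, so that its partial products telescope to these. *)
Lemma exists_universal_radix (Y : topologicalType) (psi : Y -> Y) (y0 : Y) :
  indecomposable psi ->
  exists k, [/\ odometer_type k, forall n, has_clock psi (radix k n)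
    & forall m, 0 < m -> has_clock psi m -> m %| radix k m].
Proof.
move=> ipsi; pose e := lcm_upto (has_clock psi).
have e0 n : 0 < e n := lcm_upto_gt0 _ n.
have eS n : e n %| e n.+1.
  by rewrite /e /=; case: asboolP => // _; exact: dvdn_lcml.
exists (fun n => e n.+1 %/ e n).
have -> : radix (fun n => e n.+1 %/ e n) = e.
  apply/funext; elim=> [|n IHn]; first by rewrite /radix big_ord0.
  by rewrite radixS IHn mulnC divnK.
split=> [n|n|m]; last exact: dvdn_lcm_upto.
- by rewrite divn_gt0 // dvdn_leq.
- elim: n => [|n IHn]; first exact: has_clock1.
  rewrite /e /=; case: asboolP => // cn.
  exact: (has_clock_lcm y0).
Qed.

(** * Factor maps between odometers *)

(** The divisibility gives the odometer of type [k] the clocks required by the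
    criterion; sending [alpha y0] to [beta y0] makes the triangle commute at
    [y0], hence everywhere. *)
Lemma factor_through_odometer (Y : topologicalType) (psi : Y -> Y)
    (k l : nat -> nat) (y0 : Y) (alpha : Y -> odometer_space k)
    (beta : Y -> odometer_space l) :
  odometer_type l -> compact [set: Y] -> indecomposable psi ->
  factor_map psi (@odometer k) alpha -> factor_map psi (@odometer l) beta ->
  (forall n, exists N, radix l n %| radix k N) ->
  exists gamma, factor_map (@odometer k) (@odometer l) gamma /\
    beta = gamma \o alpha.
Proof.
move=> l0 cY ipsi falpha fbeta dvd_lk.
have fk : is_factor psi (@odometer k) by exists alpha.
have clocks n : has_clock (@odometer k) (radix l n).
  have [N dvN] := dvd_lk n; apply: has_clock_dvd dvN _.
  by exists (@odo_val k N); exact: clock_odo_val.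
have [gamma [fgamma g0]] := factor_of_clocks (alpha y0) (beta y0) l0
  (factor_compact fk cY) (factor_indecomposable fk ipsi) clocks.
exists gamma; split=> //.
apply: (factor_map_odometer_unique l0 ipsi fbeta
  (factor_map_comp falpha fgamma) (y0 := y0)).
by rewrite /= g0.
Qed.

(** Factor maps exchanging two points [y0] and [z0] are mutually inverse, since
    both composites agree with the identity at one point. *)
Lemma conjugate_odometers (k l : nat -> nat) (y0 : odometer_space k)
    (z0 : odometer_space l) :
  odometer_type k -> odometer_type l ->
  compact [set: odometer_space k] -> compact [set: odometer_space l] ->
  indecomposable (@odometer k) -> indecomposable (@odometer l) ->
  is_factor (@odometer k) (@odometer l) ->
  is_factor (@odometer l) (@odometer k) ->
  conjugate (@odometer k) (@odometer l).
Proof.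
move=> k0 l0 ck cl ik il kl lk.
have [gamma [fgamma g0]] := factor_of_clocks y0 z0 l0 ck ik
  (fun n => factor_has_clock n kl).
have [delta [fdelta d0]] := factor_of_clocks z0 y0 k0 cl il
  (fun n => factor_has_clock n lk).
have idf m : factor_map (@odometer m) (@odometer m) id.
  by split=> // [x|]; [exact: cvg_id|rewrite image_id].
have dgK : delta \o gamma = id.
  apply: (factor_map_odometer_unique k0 ik (factor_map_comp fgamma fdelta)
    (idf k) (y0 := y0)).
  by rewrite /= g0.
have gdK : gamma \o delta = id.
  apply: (factor_map_odometer_unique l0 il (factor_map_comp fdelta fgamma)
    (idf l) (y0 := z0)).
  by rewrite /= d0.
exists gamma; split=> //; split; first by case: fgamma.
exists delta; split; first by case: fdelta.
- by move=> y; rewrite -[LHS]/((delta \o gamma) y) dgK.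
- by move=> y; rewrite -[LHS]/((gamma \o delta) y) gdK.
Qed.

Theorem theorem4p12 (X : topologicalType) (phi : X -> X)
    (hphi : cantor_minimal_system phi) :
  exists k : nat -> nat,
    [/\ maximal_odometer_factor phi k,
        (forall k' : nat -> nat, maximal_odometer_factor phi k' ->
           conjugate (@odometer k) (@odometer k'))
      & exists alpha : X -> odometer_space k,
          factor_map phi (@odometer k) alpha /\
          (forall (l : nat -> nat) (beta : X -> odometer_space l),
             odometer_type l -> factor_map phi (@odometer l) beta ->
             exists! gamma : odometer_space k -> odometer_space l,
               factor_map (@odometer k) (@odometer l) gamma /\
               beta = gamma \o alpha)].
Proof.
have [[f [cf [g [cg fK gK]]]] minphi] := hphi.
have iphi := minimal_indecomposable minphi.
have cX : compact [set: X].
  have -> : [set: X] = range g.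
    by rewrite eqEsubset; split=> // x _; exists (f x).
  apply: continuous_compact cantor_space_compact.
  exact: continuous_subspaceT.
pose x0 := g (fun=> false).
have [k [k0 clocks univ]] := exists_universal_radix x0 iphi.
have [alpha [falpha _]] :=
  factor_of_clocks x0 (fun n => Ordinal (k0 n)) k0 cX iphi clocks.
have good l : is_factor phi (@odometer l) ->
    compact [set: odometer_space l] /\ indecomposable (@odometer l).
  move=> phil; split; first exact: (factor_compact phil cX).
  exact: (factor_indecomposable phil iphi).
have fk : is_factor phi (@odometer k) by exists alpha.
have [ck ik] := good _ fk.
have lift l (l0 : odometer_type l) beta : factor_map phi (@odometer l) beta ->
    exists gamma, factor_map (@odometer k) (@odometer l) gamma /\
      beta = gamma \o alpha.
  move=> fbeta; apply: (factor_through_odometer x0 l0 cX iphi falpha fbeta) => n.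
  exists (radix l n); apply: univ; first exact: radix_gt0.
  by apply: factor_has_clock; exists beta.
have maxk : maximal_odometer_factor phi k.
  split=> // l l0 [beta fbeta].
  by have [gamma [fgamma _]] := lift l l0 beta fbeta; exists gamma.
exists k; split=> //; last first.
  exists alpha; split=> // l beta l0 fbeta.
  have [gamma [fgamma gE]] := lift l l0 beta fbeta.
  exists gamma; split=> // gamma' [_ gE'].
  apply/funext => y; have [_ sa _] := falpha.
  have [x _ <-] : range alpha y by rewrite sa.
  by have := congr1 (@^~ x) gE; rewrite /= => <-; rewrite gE'.
move=> k' [k'0 fk' maxk'].
have [_ _ /(_ _ k'0 fk') kk'] := maxk.
have [ck' ik'] := good _ fk'.
have [beta _] := fk'.
exact: (conjugate_odometers (alpha x0) (beta x0) k0 k'0 ck ck' ik ik' kk'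
  (maxk' _ k0 fk)).
Qed.
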